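(* Let $\mathcal{T}$ be a class of non-singular affine transformations of $\mathbb{R}^d$ and let $D$ be a depth function (with values in $[0,1]$) that is invariant under every $T\in\mathcal{T}$, i.e. $D(T(\mathbf{x})\mid P_{T(\mathbf{X})})=D(\mathbf{x}\mid P_{\mathbf{X}})$. Let $W$ be a probability measure on $(0,1]$, absolutely continuous with respect to Lebesgue measure with a bounded measurable density, which remains unchanged under any transformation of the distribution. Then the $\beta$-integrated local depth is also invariant under all $T\in\mathcal{T}$: for every random vector $\mathbf{X}$ in $\mathbb{R}^d$ and $\mathbf{x}\in\mathbb{R}^d$, $$ILD(T(\mathbf{x})\mid P_{T(\mathbf{X})})=ILD(\mathbf{x}\mid P_{\mathbf{X}}).$$
   Context: Write $P_{\mathbf{X}}$ for the distribution of a random vector $\mathbf{X}$. A depth function is a map $D(\cdot\mid P):\mathbb{R}^d\to[0,1]$ defined for every probability distribution $P$ on $\mathbb{R}^d$ which, besides $\mathcal{T}$-invariance, satisfies: (maximality at center) if $P$ is centrally symmetric about $\boldsymbol\theta$, then $D(\boldsymbol\theta\mid P)=\sup_{\mathbf{x}}D(\mathbf{x}\mid P)$; (monotonicity on rays) if $\boldsymbol\theta$ maximizes $D(\cdot\mid P)$, then $D(\mathbf{x}\mid P)\le D((1-\gamma)\boldsymbol\theta+\gamma\mathbf{x}\mid P)$ for all $\mathbf{x}$ and $\gamma\in[0,1]$; (vanishing at infinity) $D(\mathbf{x}\mid P)\to0$ as $\|\mathbf{x}\|\to\infty$. Central regions: for a distribution $Q$ and $\alpha\in(0,1]$, $R_\alpha(Q)=\{\mathbf{z}:D(\mathbf{z}\mid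 Q)\ge\alpha\}$; for $\beta\in(0,1]$, $R^\beta(Q)=\bigcap_{\alpha\in A(\beta)}R_\alpha(Q)$ with $A(\beta)=\{\alpha: Q(R_\alpha(Q))\ge\beta\}$ (empty intersection $=\mathbb{R}^d$). $\beta$-local depth: let $R^\beta_{\mathbf{x}}=R^\beta\big(\tfrac12P_{\mathbf{X}}+\tfrac12P_{2\mathbf{x}-\mathbf{X}}\big)$ and let $P^\beta_{\mathbf{x}}$ be $P_{\mathbf{X}}$ conditioned on $R^\beta_{\mathbf{x}}$ (assumed to have positive $P_{\mathbf X}$-probability). Then $LD^\beta(\mathbf{x}\mid P_{\mathbf{X}})=D(\mathbf{x}\mid P^\beta_{\mathbf{x}})$. $\beta$-integrated local depth: $ILD(\mathbf{x}\mid P_{\mathbf{X}})=\int_0^1LD^\beta(\mathbf{x}\mid P_{\mathbf{X}})\,dW(\beta)$. *)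

(* Defs.v *)
From HB Require Import structures.
From mathcomp Require Import all_boot all_order all_algebra.
From mathcomp Require Import all_classical all_reals all_analysis.

Set Implicit Arguments.
Unset Strict Implicit.
Unset Printing Implicit Defensive.

Import Order.TTheory GRing.Theory Num.Theory.
Import numFieldNormedType.Exports.

Local Open Scope classical_set_scope.
Local Open Scope ring_scope.

(* R^d is 'cV[R]_d with its Borel sigma-algebra, which the library does not
   provide on matrices. *)
HB.instance Definition _ (R : realType) (d : nat) :=
  @isMeasurable.Build (sigma_display (@open 'cV[R]_d)) 'cV[R]_d
    <<s @open 'cV[R]_d >> (@sigma_algebra0 _ setT _)
    (@sigma_algebraC _ _) (@sigma_algebra_bigcup _ setT _).

Lemma continuous_measurable_cV (R : realType) (d : nat)
    (f : 'cV[R]_d -> 'cV[R]_d) :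
  continuous f -> measurable_fun [set: 'cV[R]_d] f.
Proof.
move=> cf; apply: (@measurability _ _ _ _ setT f (@open 'cV[R]_d)) => //.
move=> _ [B oB <-]; rewrite setTI; apply: sub_sigma_algebra.
by move/continuousP : cf; apply.
Qed.

Section affine.
Context (R : realType) (d : nat).

Record affine := Affine {
  affine_mx : 'M[R]_d;
  affine_vec : 'cV[R]_d;
  affine_unit : affine_mx \in unitmx }.

Definition affine_fun (T : affine) (x : 'cV[R]_d) : 'cV[R]_d :=
  affine_mx T *m x + affine_vec T.

Lemma affine_fun_continuous T : continuous (affine_fun T).
Proof.
rewrite /affine_fun; move: (affine_mx T) (affine_vec T) => A b x.
have mulE (y : 'cV[R]_d) : A *m y = \sum_j (y j ord0) *: col j A.
  apply/matrixP => i k; rewrite (ord1 k) mxE summxE.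
  by apply: eq_bigr => j _; rewrite !mxE mulrC.
suff cA : (A *m y) @[y --> x] --> A *m x by exact: cvgD cA (cvg_cst _).
rewrite mulE; under eq_fun do rewrite mulE.
apply: (@cvg_big _ _ _ _ _ add_continuous _ (nbhs x)) => j _.
by apply: cvgZr_tmp; exact: coord_continuous.
Qed.

HB.instance Definition _ (T : affine) :=
  isMeasurableFun.Build _ _ _ _ (affine_fun T)
    (continuous_measurable_cV (@affine_fun_continuous T)).

Definition reflection (x y : 'cV[R]_d) : 'cV[R]_d := x *+ 2 - y.

Lemma reflection_continuous x : continuous (reflection x).
Proof. by move=> y; exact: cvgB (cvg_cst _) cvg_id. Qed.

HB.instance Definition _ (x : 'cV[R]_d) :=
  isMeasurableFun.Build _ _ _ _ (reflection x)
    (continuous_measurable_cV (@reflection_continuous x)).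

End affine.

Coercion affine_fun : affine >-> Funclass.

Section probabilities.
Context (disp : measure_display) (T : measurableType disp) (R : realType).

Definition half : {nonneg R} := (2^-1)%:nng.

Definition half_mix (P Q : probability T R) : set T -> \bar R :=
  measure_add (mscale half P) (mscale half Q).

HB.instance Definition _ (P Q : probability T R) :=
  Measure.on (half_mix P Q).

Lemma half_mixE (P Q : probability T R) (A : set T) :
  half_mix P Q A = ((2^-1)%:E * P A + (2^-1)%:E * Q A)%E.
Proof. exact: measure_addE. Qed.

Lemma half_mix_setT (P Q : probability T R) : half_mix P Q [set: T] = 1%E.
Proof.
rewrite half_mixE (probability_setT P) (probability_setT Q) !mule1 -EFinD.
by rewrite -[RHS]/(1%:E) [in RHS](splitr 1) mul1r.
Qed.

HB.instance Definition _ (P Q : probability T R) :=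
  Measure_isProbability.Build _ _ _ (half_mix P Q) (half_mix_setT P Q).

(* P conditioned on B; P itself is a dummy value when B is not measurable or
   P B = 0. *)
Definition conditioned (P : probability T R) (B : set T) : probability T R :=
  match pselect (measurable B) with
  | left mB => mnormalize (mrestr P mB) P
  | right _ => P
  end.

End probabilities.

Section depth.
Context (R : realType) (d : nat).
Local Notation Rd := 'cV[R]_d.
Implicit Types (D : Rd -> probability Rd R -> R) (P Q : probability Rd R).

(* X - theta and theta - X have the same distribution, for X of law P *)
Definition centrally_symmetric P (theta : Rd) : Prop :=
  forall A : set Rd, measurable A ->
    P [set y | A (y - theta)] = P [set y | A (theta - y)].

Definition maximizes D P (theta : Rd) : Prop :=
  forall y : Rd, D y P <= D theta P.

Record is_depth D : Prop := IsDepth {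
  depth_range : forall x P, 0 <= D x P <= 1;
  depth_center : forall P theta, centrally_symmetric P theta ->
    D theta P = sup (range (fun x => D x P));
  depth_rays : forall P theta, maximizes D P theta ->
    forall (x : Rd) (gamma : R), 0 <= gamma <= 1 ->
      D x P <= D ((1 - gamma) *: theta + gamma *: x) P;
  depth_vanishing : forall P (e : R), 0 < e ->
    exists M : R, forall x : Rd, M < `|x| -> `|D x P| < e }.

Definition depth_invariant D (T : affine R d) : Prop :=
  forall (disp : measure_display) (Omega : measurableType disp)
    (Pr : probability Omega R) (X : {RV Pr >-> Rd}) (x : Rd),
    D (T x) (distribution Pr (T \o X)) = D x (distribution Pr X).

(* Level regions are not assumed measurable: Q is total on sets, and the
   value of Q is only meaningful on measurable ones. *)
Definition level_region D Q (alpha : R) : set Rd := [set z | alpha <= D z Q].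

Definition beta_region D Q (beta : R) : set Rd :=
  \bigcap_(alpha in [set a : R |
      0 < a <= 1 /\ (beta%:E <= Q (level_region D Q a))%E])
    level_region D Q alpha.

(* distribution P (reflection x) is the law of 2x - X, for X of law P *)
Definition local_region D P (x : Rd) (beta : R) : set Rd :=
  beta_region D (half_mix P (distribution P (reflection x))) beta.

Definition LD D (beta : R) (x : Rd) P : R :=
  D x (conditioned P (local_region D P x beta)).

(* For an integrand that is not measurable in beta, the integral is the
   library's total one (a lower integral). *)
Definition ILD D (W : probability (measurableTypeR R) R) (x : Rd) P : \bar R :=
  (\int[W]_(beta in `]0%R, 1%R]) (LD D beta x P)%:E)%E.

End depth.

Definition has_bounded_density (R : realType)
    (W : probability (measurableTypeR R) R) : Prop :=
  exists w : R -> R,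
    [/\ measurable_fun [set: R] w,
        (forall t, 0 <= w t),
        (exists M : R, forall t, w t <= M) &
        forall A : set R, measurable A ->
          W A = (\int[lebesgue_measure]_(t in A) (w t)%:E)%E].

(* Main.v *)
(* Every construction entering the local depth commutes with the push-forward
   along T: since T (2x - y) = 2 T x - T y, the symmetrized law of the image is
   the image of the symmetrized law, so the central regions correspond under T,
   and so do the conditioned laws.  All these identities hold on arbitrary
   subsets of R^d, so the level regions, on which the laws are evaluated, may
   be non-measurable. *)

Require Import Defs.
From HB Require Import structures.
From mathcomp Require Import all_boot all_order all_algebra.
From mathcomp Require Import all_classical all_reals all_analysis.

Set Implicit Arguments.
Unset Strict Implicit.
Unset Printing Implicit Defensive.

Import Order.TTheory GRing.Theory Num.Theory.
Import numFieldNormedType.Exports.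

Local Open Scope classical_set_scope.
Local Open Scope ring_scope.

(** A depth takes a bundled law as argument, so equal values on sets must be lifted to equal
    records. All remaining fields are proofs, hence equal by proof irrelevance. *)
Lemma probability_ext (disp : measure_display) (T : measurableType disp)
    (R : realType) (P Q : probability T R) :
  (P : set T -> \bar R) = Q -> P = Q.
Proof.
move: P Q => [p [[a b] [c] [e] [f] [g] [h] [i]]] [q cq] /= pq; subst q.
case: cq => [[a' b'] [c'] [e'] [f'] [g'] [h'] [i']].
(* The types of later fields depend on earlier ones, so these are identified in order. *)
have [Ea Eb] := (Prop_irrelevance a' a, Prop_irrelevance b' b).
subst a' b'; have Ec := Prop_irrelevance c' c; subst c'.
by congr Probability.Pack; congr Probability.Class; congr (_ _);
  exact: Prop_irrelevance.
Qed.

Lemma conditionedE (disp : measure_display) (T : measurableType disp)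
    (R : realType) (P : probability T R) (B : set T) (mB : measurable B) :
  conditioned P B = mnormalize (mrestr P mB) P.
Proof.
rewrite /conditioned; case: pselect => [mB'|//].
by rewrite (Prop_irrelevance mB' mB).
Qed.

Lemma conditioned_nonmeasurable (disp : measure_display)
    (T : measurableType disp) (R : realType) (P : probability T R)
    (B : set T) : ~ measurable B -> conditioned P B = P.
Proof. by rewrite /conditioned; case: pselect. Qed.

Section affine_pushforward.
Context (R : realType) (d : nat) (T : affine R d).
Local Notation Rd := 'cV[R]_d.
Implicit Types (P Q : probability Rd R) (B : set Rd).

Lemma affine_inv_unit : invmx (affine_mx T) \in unitmx.
Proof. by rewrite unitmx_inv affine_unit. Qed.

Definition affine_inv : affine R d :=
  Affine (- (invmx (affine_mx T) *m affine_vec T)) affine_inv_unit.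

Lemma affine_invK : cancel affine_inv T.
Proof.
move=> y; rewrite /affine_fun /= mulmxDr mulmxN !mulmxA.
by rewrite (mulmxV (affine_unit T)) !mul1mx subrK.
Qed.

Lemma affine_reflection (x y : Rd) : reflection (T x) (T y) = T (reflection x y).
Proof.
rewrite /reflection /affine_fun !mulr2n mulmxBr mulmxDr.
by rewrite opprD (addrACA (_ *m x)) [LHS]addrACA addrK.
Qed.

(** [T] and its inverse are both Borel. The equivalence makes [conditioned] take the same branch for
    [B] and for its preimage. *)
Lemma measurable_affine_preimage B : measurable (T @^-1` B) <-> measurable B.
Proof.
have mpre (S : affine R d) C : measurable C -> measurable (S @^-1` C).
  by move=> mC; rewrite -[X in measurable X]setTI; exact: measurable_funPT.
split=> [/(mpre affine_inv)|]; last exact: mpre.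
by congr measurable; apply/seteqP; split=> y /=; rewrite affine_invK.
Qed.

Lemma conditioned_affine P B :
  conditioned (distribution P T) B
  = distribution (conditioned P (T @^-1` B)) T :> probability Rd R.
Proof.
(* For non-measurable [B] both sides are the push-forward of the dummy value [P]. *)
have [mB|nmB] := pselect (measurable B); last first.
  by rewrite !conditioned_nonmeasurable // measurable_affine_preimage.
have mTB : measurable (T @^-1` B) by apply/measurable_affine_preimage.
rewrite (conditionedE _ mB) (conditionedE _ mTB).
apply: probability_ext; apply/funext => A /=.
(* Both sides normalize by the mass of the preimage of [B]; if it is zero, both fall back on the
   push-forward of [P]. *)
by rewrite /distribution /pushforward /mnormalize /mrestr /=; case: ifP.
Qed.

Lemma half_mix_affine P (x : Rd) :
  half_mix (distribution P T) (distribution (distribution P T) (reflection (T x)))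
  = distribution (half_mix P (distribution P (reflection x))) T
  :> probability Rd R.
Proof.
apply: probability_ext; apply/funext => A /=.
rewrite half_mixE /distribution /pushforward half_mixE /=.
congr (_ + _ * P _)%E; apply/seteqP.
by split=> y /=; rewrite affine_reflection.
Qed.

Section invariant_depth.
Context (D : Rd -> probability Rd R -> R) (invD : depth_invariant D T).

(** Invariance is assumed for random vectors; the identity on the probability space $(\mathbb{R}^d,
    P)$ is one with law [P]. *)
Lemma depth_affine P (x : Rd) : D (T x) (distribution P T) = D x P.
Proof.
pose idX : {RV P >-> Rd} :=
  HB.pack (@id Rd) (isMeasurableFun.Build _ _ _ _ _ (@measurable_id _ Rd setT)).
have -> : distribution P T = distribution P (T \o idX) :> probability Rd R
  by exact: probability_ext.
by rewrite (invD idX); congr (D _ _); exact: probability_ext.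
Qed.

Lemma level_region_affine Q (alpha : R) :
  T @^-1` level_region D (distribution Q T) alpha = level_region D Q alpha.
Proof.
by apply/seteqP; split=> y; rewrite /level_region /= depth_affine.
Qed.

Lemma beta_region_affine Q (beta : R) :
  T @^-1` beta_region D (distribution Q T) beta = beta_region D Q beta.
Proof.
rewrite /beta_region preimage_bigcap.
apply: eq_bigcap => [|a _]; last exact: level_region_affine.
(* The index sets agree: the image law gives a level region the [Q]-mass of its preimage, which is
   the level region of [Q]. *)
by split=> a; rewrite /= /distribution /pushforward level_region_affine.
Qed.

Lemma local_region_affine P (x : Rd) (beta : R) :
  T @^-1` local_region D (distribution P T) (T x) beta
  = local_region D P x beta.
Proof. by rewrite /local_region half_mix_affine beta_region_affine. Qed.

Lemma LD_affine P (x : Rd) (beta : R) :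
  LD D beta (T x) (distribution P T) = LD D beta x P.
Proof.
(* Invariance of [D] enters twice: at the symmetrized law, through the regions, and at the
   conditioned law. *)
by rewrite /LD conditioned_affine local_region_affine depth_affine.
Qed.

End invariant_depth.

End affine_pushforward.

Theorem mainTheorem3 (R : realType) (d : nat)
    (TT : set (affine R d))
    (D : 'cV[R]_d -> probability 'cV[R]_d R -> R)
    (hD : is_depth D)
    (hinv : forall T : affine R d, TT T -> depth_invariant D T)
    (W : probability (measurableTypeR R) R)
    (hW01 : W `]0, 1]%classic = 1%E)
    (hW : has_bounded_density W)
    (disp : measure_display) (Omega : measurableType disp)
    (Pr : probability Omega R) (X : {RV Pr >-> 'cV[R]_d}) (x : 'cV[R]_d)
    (hpos : forall beta : R, 0 < beta <= 1 ->
      (0 < distribution Pr X (local_region D (distribution Pr X) x beta))%E)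
    (T : affine R d) (hT : TT T) :
  ILD D W (T x) (distribution Pr (T \o X)) = ILD D W x (distribution Pr X).
Proof.
have -> : distribution Pr (T \o X) = distribution (distribution Pr X) T
  :> probability 'cV[R]_d R.
  exact: probability_ext.
(* The integrands agree at every [beta], and [W] is the same on both sides. *)
by apply: eq_integral => beta _; rewrite (LD_affine (hinv _ hT)).
Qed.
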